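(* Let $g\in L^2(\mathbb{R})$ be real-valued with $\|g\|_2=1$. Let $a,b\in\mathbb{R}$ be nonzero and distinct, and let $\Lambda = \{(0,0),(0,1),(a,0),(b,0)\}$. Then the functions $g(x)$, $e^{2\pi i x}g(x)$, $g(x-a)$, $g(x-b)$ are linearly independent in $L^2(\mathbb{R})$. *)

(* Defs.v *)
From HB Require Import structures.
From mathcomp Require Import all_boot all_order all_algebra.
From mathcomp Require Import all_classical all_reals all_analysis.
From mathcomp Require Import complex.
Set Implicit Arguments. Unset Strict Implicit. Unset Printing Implicit Defensive.
Import Order.TTheory GRing.Theory Num.Theory.
Local Open Scope ring_scope.
Local Open Scope complex_scope.

Definition tf_comb (R : realType) (g : R -> R) (a b : R) (c0 c1 c2 c3 : R[i]) (x : R) : R[i] :=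
  c0 * (g x)%:C
  + c1 * ((cos (2 * pi * x)) +i* (sin (2 * pi * x))) * (g x)%:C
  + c2 * (g (x - a))%:C
  + c3 * (g (x - b))%:C.

(* Main.v *)
Require Import Defs.
From HB Require Import structures.
From mathcomp Require Import all_boot all_order all_algebra.
From mathcomp Require Import all_classical all_reals all_analysis.
From mathcomp Require Import complex.
From mathcomp Require Import finmap measurable_realfun ring lra.
Import Order.TTheory GRing.Theory Num.Theory.
Import numFieldNormedType.Exports.
Local Open Scope ring_scope.

(** Since [g] is real, a relation
    [(c0 + c1 e(x)) g(x) + c2 g(x - a) + c3 g(x - b) = 0] splits into two real
    relations.  If [c1 <> 0], either a real combination of them reads
    [T g = 0] with [T] a nonzero trigonometric polynomial, whose zero set is
    countable, or they solve to [g(x - a) = P(x) g(x)] and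
    [g(x - b) = Q(x) g(x)] with [P], [Q] real of degree one.  In the latter
    case commutation of the two translations forces [P(x - a)^2 = P(x)^2], and
    integrating the coboundary of [(P^2 - 1) g^2] along [x |-> x - a] gives
    [(P^2 - 1) g = 0], which is impossible as [P] is not constant.  If
    [c1 = 0] it remains to prove that three translates are independent over
    the reals: a relation [k g + l g(x - a) + m g(x - b) = 0] also holds with
    [- a], [- b] in place of [a], [b], eliminating the translates by [b] yields
    [g(x + a) + g(x - a) = k' g(x)], and this recurrence has no nonzero
    solution in L^2: if [|k'| < 2] it conserves a positive definite quadratic
    form, which would be integrable and periodic, and otherwise it factors into
    relations of the form [h(x - a) = k'' h(x)]. *)

(** * Translation invariance of Lebesgue measure and coboundaries *)

Section translation.
Context {R : realType}.
Local Open Scope classical_set_scope.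
Local Open Scope ring_scope.
Notation mu := (@lebesgue_measure R).
Implicit Types (f g u v : R -> R) (a b t : R).

#[local] Instance lebesgue_ae_filter : Filter (nbhs (almost_everywhere mu)).
Proof. exact: ae_filter_ringOfSetsType. Qed.

Let shift a : R -> measurableTypeR R := fun x => x - a.

Lemma measurable_subr a : measurable_fun [set: R] (fun x : R => x - a).
Proof. exact: measurable_funB. Qed.

Lemma lebesgue_measure_translate a (A : set R) : measurable A ->
  mu ((fun x => x - a) @^-1` A) = mu A.
Proof.
move=> mA; apply/esym.
have ms : measurable_fun [set: measurableTypeR R] (shift a).
  exact: measurable_subr.
rewrite -[RHS]/(pushforward mu (shift a) A).
apply: lebesgue_measure_unique => //= _ [[x y]] _ <-.
rewrite /pushforward /=.
have -> : shift a @^-1` `]x, y] = `]x + a, y + a]%classic.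
  by apply/seteqP; split=> z /=; rewrite !in_itv/= /shift ltrBrDr lerBlDr.
rewrite !lebesgue_measure_itv/= !lte_fin ltrD2r; case: ifP => // _.
by rewrite -!EFinD; congr EFin; ring.
Qed.

Lemma ae_translate a (P : R -> Prop) :
  {ae mu, forall x, P x} -> {ae mu, forall x, P (x - a)}.
Proof.
case=> N [mN N0 PN]; exists ((fun x => x - a) @^-1` N); split.
- rewrite -[X in measurable X]setTI; exact: (measurable_subr a).
- by rewrite lebesgue_measure_translate.
- by move=> x /= Px; apply: PN.
Qed.

Lemma integrable_translate a u :
  mu.-integrable setT (EFin \o u) ->
  mu.-integrable setT (EFin \o (fun x => u (x - a))).
Proof.
move=> /integrableP[mf fi]; apply/integrableP; split.
  apply/measurable_EFinP; apply: measurableT_comp (measurable_subr a).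
  exact/measurable_EFinP.
have ms : measurable_fun [set: measurableTypeR R] (shift a).
  exact: measurable_subr.
rewrite -(_ : (\int[mu]_x `|(EFin \o u) x| =
   \int[mu]_x `|(EFin \o (fun x => u (x - a)%R)) x|)%E)//.
transitivity (\int[pushforward mu (shift a)]_x `|(EFin \o u) x|)%E.
  apply: eq_measure_integral => //= A mA _.
  by rewrite -[LHS](lebesgue_measure_translate a).
rewrite ge0_integral_pushforward//=.
by apply/measurable_EFinP/measurableT_comp => //; exact/measurable_EFinP.
Qed.

Lemma Rintegral_translate a u :
  mu.-integrable setT (EFin \o u) ->
  \int[mu]_x u (x - a) = \int[mu]_x u x.
Proof.
move=> fi; have /integrableP[mf _] := fi.
have ms : measurable_fun [set: measurableTypeR R] (shift a).
  exact: measurable_subr.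
rewrite /Rintegral; congr fine; apply/esym.
transitivity (\int[pushforward mu (shift a)]_x (EFin \o u) x)%E.
  apply: eq_measure_integral => //= A mA _.
  by rewrite -[LHS](lebesgue_measure_translate a).
rewrite integral_pushforward//=.
exact: (integrable_translate a).
Qed.

Lemma integrable_boundedM (h u : R -> R) :
  measurable_fun setT h -> [bounded h x | x in [set: R]] ->
  mu.-integrable setT (EFin \o u) ->
  mu.-integrable setT (EFin \o (fun x => h x * u x)).
Proof.
move=> mh bh ui.
suff : mu.-integrable setT ((EFin \o h) \* (EFin \o u))%E.
  by apply: eq_integrable => // x _; rewrite /= -EFinM.
exact: integrableMr.
Qed.

(** Integrability is included because [fine] sends an infinite integral to 0. *)
Definition null_mean u :=
  mu.-integrable setT (EFin \o u) /\ \int[mu]_x u x = 0.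

Lemma null_meanD u v : null_mean u -> null_mean v -> null_mean (u \+ v).
Proof.
move=> [ui u0] [vi v0]; split; first exact: (integrableD measurableT ui vi).
by rewrite RintegralD// u0 v0 addr0.
Qed.

Lemma null_meanZ k u : null_mean u -> null_mean (k \*o u).
Proof.
move=> [ui u0]; split; first exact: (integrableZl measurableT k ui).
by rewrite RintegralZl// u0 mulr0.
Qed.

Lemma null_mean_translate a u : mu.-integrable setT (EFin \o u) ->
  null_mean (fun x => u (x - a) - u x).
Proof.
move=> ui; have uai := integrable_translate a _ ui.
split; first exact: (integrableB measurableT uai ui).
by rewrite RintegralB// Rintegral_translate// subrr.
Qed.

Lemma null_mean_ge0 u : null_mean u -> {ae mu, forall x, 0 <= u x} ->
  {ae mu, forall x, u x = 0}.
Proof.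
move=> [ui u0] uge0; have /integrableP[mf _] := ui.
have : (\int[mu]_x `|(EFin \o u) x| = 0)%E.
  transitivity (\int[mu]_x (EFin \o u) x)%E; last first.
    have /fineK <- := integrable_fin_num measurableT ui.
    by congr EFin.
  apply: ae_eq_integral => //; first exact: measurableT_comp.
  suff : {ae mu, forall x, setT x -> `|(u x)%:E|%E = (u x)%:E} by [].
  by apply: filterS uge0 => x ux _ /=; rewrite ger0_norm.
move/(ae_eq_integral_abs mu measurableT mf).
by apply: filterS => x /(_ I) [].
Qed.

(** A coboundary of an integrable function has integral zero by translation invariance, so it cannot
    have a constant sign without vanishing. *)
Lemma coboundary_ge0 a u : mu.-integrable setT (EFin \o u) ->
  {ae mu, forall x, 0 <= u (x - a) - u x} ->
  {ae mu, forall x, u (x - a) - u x = 0}.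
Proof. by move=> ui; apply: null_mean_ge0; exact: null_mean_translate. Qed.

Definition square_integrable g := measurable_fun setT g /\
  mu.-integrable setT (EFin \o (fun x => g x ^+ 2)).

Lemma square_integrable_translate a g :
  square_integrable g -> square_integrable (fun x => g (x - a)).
Proof.
move=> [mg gi]; split; last exact: (integrable_translate a _ gi).
by apply: measurableT_comp (measurable_subr a).
Qed.

Lemma square_integrableM f g : square_integrable f -> square_integrable g ->
  mu.-integrable setT (EFin \o (f \* g)).
Proof.
move=> [mf fi] [mg gi].
apply: (le_integrable measurableT _ _ (integrableD measurableT fi gi)).
  by apply/measurable_EFinP; exact: measurable_funM.
move=> x _ /=; rewrite lee_fin [leRHS]ger0_norm; last first.
  by rewrite addr_ge0 ?sqr_ge0.
rewrite normrM -(real_normK (num_real (f x))) -(real_normK (num_real (g x))).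
have := sqr_ge0 (`|f x| - `|g x|).
have := normr_ge0 (f x); have := normr_ge0 (g x); nra.
Qed.

Lemma square_integrable_comb k l f g :
  square_integrable f -> square_integrable g ->
  square_integrable (fun x => k * f x + l * g x).
Proof.
move=> f2 g2; have fg := square_integrableM _ _ f2 g2.
have [[mf fi] [mg gi]] := (f2, g2).
split.
  by apply: measurable_funD; apply: measurable_funM.
have := integrableD measurableT (integrableZl measurableT (2 * k * l) fg)
 (integrableD measurableT (integrableZl measurableT (k ^+ 2) fi)
    (integrableZl measurableT (l ^+ 2) gi)).
apply: eq_integrable => // x _ /=.
by rewrite -!EFinM -!EFinD; congr EFin; ring.
Qed.

Lemma ae_periodic_integrable_eq0 a u : a != 0 ->
  mu.-integrable setT (EFin \o u) -> (forall x, 0 <= u x) ->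
  {ae mu, forall x, u (x - a) = u x} -> {ae mu, forall x, u x = 0}.
Proof.
wlog a0 : a / 0 < a.
  move=> H; rewrite neq_lt => /orP[a0|a0] ui u0 per; last first.
    by apply: (H a) => //; rewrite gt_eqF.
  apply: (H (- a)) => //; rewrite ?oppr_gt0// ?oppr_eq0 ?lt_eqF//.
  by apply: filterS (ae_translate (- a) _ per) => x <-; rewrite opprK addrK.
move=> _ ui u0 per.
(* A bounded, strictly monotone weight keeps [w] integrable, and periodicity turns its coboundary
   into [u] times a positive function. *)
pose w x := - atan x * u x.
have wi : mu.-integrable setT (EFin \o w).
  apply: (integrable_boundedM (fun x => - atan x)) => //.
    apply: measurable_funN.
    by apply: continuous_measurable_fun => x; exact: continuous_atan.
  exists (pi / 2); split; first exact: num_real.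
  move=> y py x _ /=; rewrite normrN (le_trans _ (ltW py))// ler_norml.
  by rewrite !ltW ?atan_gtNpi2 ?atan_ltpi2.
have wE : {ae mu, forall x, w (x - a) - w x = (atan x - atan (x - a)) * u x}.
  by apply: filterS per => x px; rewrite /w px; ring.
have lta x : 0 < atan x - atan (x - a).
  by rewrite subr_gt0 lt_atan// ltrBlDr ltrDl.
have : {ae mu, forall x, w (x - a) - w x = 0}.
  apply: coboundary_ge0 => //; apply: filterS wE => x ->.
  by rewrite mulr_ge0// ltW.
apply: filterS2 wE => x -> /eqP; rewrite mulf_eq0 gt_eqF//=.
by move/eqP.
Qed.

Lemma ae_translate_multiplier a (P g : R -> R) : square_integrable g ->
  measurable_fun setT P -> [bounded P x | x in [set: R]] ->
  (forall x, P (x - a) ^+ 2 = P x ^+ 2) ->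
  {ae mu, forall x, g (x - a) = P x * g x} ->
  {ae mu, forall x, (P x ^+ 2 - 1) * g x = 0}.
Proof.
move=> [mg gi] mP [M [Mr bP]] perP gP.
(* Translating [g ^ 2] multiplies it by [P ^ 2] while the factor [P ^ 2 - 1] is unchanged, so the
   coboundary of [w] is a perfect square. *)
pose w x := (P x ^+ 2 - 1) * g x ^+ 2.
have wi : mu.-integrable setT (EFin \o w).
  apply: (integrable_boundedM (fun x => P x ^+ 2 - 1)) => //.
    apply: measurable_funB => //.
    exact: measurable_funX.
  exists ((M + 1) ^+ 2 + 1); split; first exact: num_real.
  move=> y My x _ /=.
  (* The bound is only given for constants strictly above [M]. *)
  have := bP (M + 1); rewrite ltrDl ltr01 => /(_ isT x I) /= Px.
  apply: (le_trans (ler_normB _ _)); apply: ltW; apply: le_lt_trans My.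
  rewrite normr1 lerD2r normrX; have := normr_ge0 (P x); nra.
have wE : {ae mu, forall x,
    w (x - a) - w x = ((P x ^+ 2 - 1) * g x) ^+ 2}.
  by apply: filterS gP => x px; rewrite /w px perP; ring.
have : {ae mu, forall x, w (x - a) - w x = 0}.
  by apply: coboundary_ge0 => //; apply: filterS wE => x ->; exact: sqr_ge0.
by apply: filterS2 wE => x -> /eqP; rewrite sqrf_eq0 => /eqP.
Qed.

End translation.

(** * Independence of three translates over the reals *)

Section translates.
Context {R : realType}.
Local Open Scope classical_set_scope.
Local Open Scope ring_scope.
Notation mu := (@lebesgue_measure R).
Implicit Types (f g u v : R -> R) (a b k l m : R).
#[local] Existing Instance lebesgue_ae_filter.

(** A constant multiplier gives [(k ^ 2 - 1) g = 0]; in the remaining case [k ^ 2 = 1] the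
    integrable function [g ^ 2] is periodic. *)
Lemma ae_translate_eigen_eq0 a k g : a != 0 -> square_integrable g ->
  {ae mu, forall x, g (x - a) = k * g x} -> {ae mu, forall x, g x = 0}.
Proof.
move=> a0 g2 gk.
have : {ae mu, forall x, (k ^+ 2 - 1) * g x = 0}.
  apply: (ae_translate_multiplier a (fun=> k) g) => //.
  exists `|k|; split; first exact: num_real.
  by move=> y /ltW ky x _.
have [k1 _|k1] := eqVneq (k ^+ 2 - 1) 0; last first.
  by apply: filterS => x /eqP; rewrite mulf_eq0 (negPf k1) => /eqP.
have : {ae mu, forall x, g x ^+ 2 = 0}.
  apply: (ae_periodic_integrable_eq0 a) => //.
  - by case: g2.
  - by move=> x; exact: sqr_ge0.
  - apply: filterS gk => x ->; rewrite exprMn.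
    by move/eqP : k1; rewrite subr_eq0 => /eqP ->; rewrite mul1r.
by apply: filterS => x /eqP; rewrite sqrf_eq0 => /eqP.
Qed.

Lemma ae_two_translates a k l g : a != 0 -> square_integrable g ->
  ~ {ae mu, forall x, g x = 0} ->
  {ae mu, forall x, k * g x + l * g (x - a) = 0} -> k = 0 /\ l = 0.
Proof.
move=> a0 g2 g0 kl.
have [l0|l0] := eqVneq l 0.
  split=> //; apply/eqP/negP => /negP k0; apply: g0.
  apply: filterS kl => x; rewrite l0 mul0r addr0 => /eqP.
  by rewrite mulf_eq0 (negPf k0) => /eqP.
exfalso; apply: g0; apply: (ae_translate_eigen_eq0 a (- k / l)) => //.
apply: filterS kl => x /eqP; rewrite addrC addr_eq0 => /eqP e.
by apply: (mulfI l0); rewrite e; field.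
Qed.

(** An autocorrelation integral depends only on the difference of the two shifts: the first product
    is the second one translated by [s - s']. *)
Lemma null_mean_autocorrelation s t s' t' g : square_integrable g ->
  s - t = s' - t' ->
  null_mean (fun x => g (x - s) * g (x - t) - g (x - s') * g (x - t')).
Proof.
move=> g2 st.
have gi : mu.-integrable setT (EFin \o (fun x => g (x - s') * g (x - t'))).
  by apply: square_integrableM; exact: square_integrable_translate.
have := null_mean_translate (s - s') _ gi; congr (null_mean _).
apply/funext => x; congr (g _ * g _ - _); first by ring.
rewrite [t'](_ : _ = s' - s + t); first by ring.
by rewrite -[t']opprK -[- t'](addKr s') -st; ring.
Qed.

(* The two relations are [D g = 0] and [D* g = 0] for [D] a combination of
   commuting unitary operators, so that [|D* g| = |D g|] in L^2. *)
Lemma ae_reflect_translates a b k l m g : square_integrable g ->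
  {ae mu, forall x, k * g x + l * g (x - a) + m * g (x - b) = 0} ->
  {ae mu, forall x, k * g x + l * g (x + a) + m * g (x + b) = 0}.
Proof.
move=> g2 klm.
have ac s t s' t' := @null_mean_autocorrelation s t s' t' g g2.
(* These are the terms of the difference of the two squared relations, paired by equal difference of
   shifts; the [k ^ 2] terms cancel. *)
have n1 := null_meanZ (l ^+ 2) _ (ac (- a) (- a) a a ltac:(ring)).
have n2 := null_meanZ (m ^+ 2) _ (ac (- b) (- b) b b ltac:(ring)).
have n3 := null_meanZ (2 * k * l) _ (ac 0 (- a) a 0 ltac:(ring)).
have n4 := null_meanZ (2 * k * m) _ (ac 0 (- b) b 0 ltac:(ring)).
have n5 := null_meanZ (2 * l * m) _ (ac (- a) (- b) b a ltac:(ring)).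
have n12 := null_meanD _ _ n1 n2; have n123 := null_meanD _ _ n12 n3.
have nD := null_meanD _ _ (null_meanD _ _ n123 n4) n5.
set F := (X in null_mean X) in nD.
have FE : {ae mu, forall x,
    F x = (k * g x + l * g (x + a) + m * g (x + b)) ^+ 2}.
  apply: filterS klm => x e.
  transitivity ((k * g x + l * g (x + a) + m * g (x + b)) ^+ 2 -
    (k * g x + l * g (x - a) + m * g (x - b)) ^+ 2).
    by rewrite /F /= !opprK !subr0; ring.
  by rewrite e expr0n subr0.
have : {ae mu, forall x, F x = 0}.
  by apply: null_mean_ge0 nD _; apply: filterS FE => x ->; exact: sqr_ge0.
by apply: filterS2 FE => x -> /eqP; rewrite sqrf_eq0 => /eqP.
Qed.

Lemma ae_recurrence_eq0 a k g : a != 0 -> square_integrable g ->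
  {ae mu, forall x, g (x + a) + g (x - a) = k * g x} ->
  {ae mu, forall x, g x = 0}.
Proof.
move=> a0 g2 rec.
have rec' := ae_translate a _ rec.
have [k2|k2] := ltP (k ^+ 2) 4.
  (* Completing the square: [q] below is the conserved form
     [g(x - a)^2 - k g(x - a) g(x) + g(x)^2]. *)
  pose h x := 1 * g (x - a) + (- k / 2) * g x.
  have h2 : square_integrable h.
    by apply: square_integrable_comb => //; exact: square_integrable_translate.
  pose c := 1 - k ^+ 2 / 4.
  have c0 : 0 < c by rewrite /c; lra.
  pose q x := h x ^+ 2 + c * g x ^+ 2.
  have q0 x : 0 <= q x by rewrite addr_ge0 ?sqr_ge0// mulr_ge0 ?sqr_ge0 ?ltW.
  have : {ae mu, forall x, q x = 0}.
    apply: (ae_periodic_integrable_eq0 a) => //.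
      exact: (integrableD measurableT h2.2 (integrableZl measurableT c g2.2)).
    apply: filterS rec' => x; rewrite subrK => e.
    by rewrite /q /h /c (_ : g (x - a - a) = k * g (x - a) - g x); [field|lra].
  apply: filterS => x /eqP; rewrite /q paddr_eq0 ?sqr_ge0//; last first.
    by rewrite mulr_ge0 ?sqr_ge0 ?ltW.
  by rewrite (mulf_eq0 c) (gt_eqF c0)/= !sqrf_eq0 => /andP[_ /eqP].
(* A real root of the characteristic equation [l ^ 2 - k l + 1 = 0]; the other root is [k - l], the
   eigenvalue for [h]. *)
pose l := (k + Num.sqrt (k ^+ 2 - 4)) / 2.
have lE : l ^+ 2 = k * l - 1.
  have : Num.sqrt (k ^+ 2 - 4) ^+ 2 = k ^+ 2 - 4.
    by rewrite sqr_sqrtr// subr_ge0.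
  by rewrite /l; move: (Num.sqrt _) => r ?; lra.
have l0 : l != 0 by apply/eqP => l0; move: lE; rewrite l0; lra.
pose h x := 1 * g (x - a) + (- l) * g x.
have : {ae mu, forall x, h x = 0}.
  apply: (ae_translate_eigen_eq0 a (k - l)) => //.
    by apply: square_integrable_comb => //; exact: square_integrable_translate.
  apply: filterS rec' => x; rewrite subrK => e.
  rewrite /h (_ : g (x - a - a) = k * g (x - a) - g x); last by lra.
  transitivity ((k - l) * g (x - a) + (- 1) * g x); first by ring.
  rewrite (_ : -1 = l ^+ 2 - k * l); last by rewrite lE; ring.
  by ring.
move=> h0; apply: (ae_translate_eigen_eq0 a l) => //.
by apply: filterS h0 => x; rewrite /h; lra.
Qed.

Lemma ae_three_translates a b k l m g : a != 0 -> b != 0 -> a != b ->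
  square_integrable g -> ~ {ae mu, forall x, g x = 0} ->
  {ae mu, forall x, k * g x + l * g (x - a) + m * g (x - b) = 0} ->
  [/\ k = 0, l = 0 & m = 0].
Proof.
move=> a0 b0 ab g2 g0 klm.
have [m0|m0] := eqVneq m 0.
  suff [? ?] : k = 0 /\ l = 0 by split.
  apply: (ae_two_translates a _ _ _ a0 g2 g0).
  by apply: filterS klm => x; rewrite m0 mul0r addr0.
have [l0|l0] := eqVneq l 0.
  suff [? ?] : k = 0 /\ m = 0 by split.
  apply: (ae_two_translates b _ _ _ b0 g2 g0).
  by apply: filterS klm => x; rewrite l0 mul0r addr0.
have [k0|k0] := eqVneq k 0.
  have ba : b - a != 0 by rewrite subr_eq0 eq_sym.
  suff [? ?] : l = 0 /\ m = 0 by split.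
  apply: (ae_two_translates (b - a) _ _ _ ba g2 g0).
  apply: filterS (ae_translate (- a) _ klm) => x.
  by rewrite k0 mul0r add0r opprK addrK opprB addrA.
exfalso; apply: g0.
(* The constant is what remains from [m e3 - k e1 - l e2], where the terms in [x - b] and
   [x + a - b] cancel. *)
apply: (ae_recurrence_eq0 a ((m ^+ 2 - k ^+ 2 - l ^+ 2) / (k * l))) => //.
have r1 := ae_translate (- a) _ klm.
have r2 := ae_translate b _ (ae_reflect_translates _ _ _ _ _ _ g2 klm).
apply: filterS3 klm r1 r2 => x e1 e2 e3.
apply: (mulfI (mulf_neq0 k0 l0)); rewrite mulrA mulrCA divff ?mulf_neq0// mulr1.
rewrite !opprK addrK in e2.
rewrite subrK (_ : x - b + a = x + a - b) in e3; last by ring.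
apply/esym/subr0_eq.
transitivity (m * (k * g (x - b) + l * g (x + a - b) + m * g x)
  - k * (k * g x + l * g (x - a) + m * g (x - b))
  - l * (k * g (x + a) + l * g x + m * g (x + a - b))); first by ring.
by rewrite e1 e2 e3; ring.
Qed.

End translates.

(** * Zeros of trigonometric polynomials of degree at most two *)

Section trigonometric_polynomials.
Context {R : realType}.
Local Open Scope classical_set_scope.
Local Open Scope ring_scope.
Notation mu := (@lebesgue_measure R).
Implicit Types (g : R -> R) (x r : R).
#[local] Existing Instance lebesgue_ae_filter.

Lemma finite_set_roots (F : fieldType) (p : {poly F}) : p != 0 ->
  finite_set [set x | root p x].
Proof.
move=> p0; apply: contrapT => /(infinite_set_fset (size p))[B Bp].
rewrite leqNgt => /negP; apply.
apply: max_poly_roots => //; last exact: fset_uniq.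
by apply/allP => x xB; exact: Bp.
Qed.

Lemma cos_2piD_int x (n : int) : cos (2 * pi * (x + n%:~R)) = cos (2 * pi * x).
Proof.
have per k y : cos (2 * pi * (y + k%:R)) = cos (2 * pi * y).
  elim: k => [|k <-]; first by rewrite addr0.
  rewrite -[RHS](cosD2pi (2 * pi * (y + k%:R))); congr cos.
  by rewrite -natr1 -[pi *+ 2]mulr_natr; ring.
case: n => n; first exact: per.
by rewrite NegzE mulrNz -[in RHS](subrK n.+1%:R x) per.
Qed.

Lemma countable_cos_fiber r : countable [set x | cos (2 * pi * x) = r].
Proof.
pose c := acos r / (2 * pi).
have p0 := @pi_gt0 R.
apply: (@sub_countable _ _ _
  (* The solutions have the form [n + c] or [n - c]; the boolean carries the sign. *)
  ((fun ns : int * bool => ns.1%:~R + (-1) ^+ ns.2 * c) @` setT)).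
  apply: subset_card_le => x /= xr.
  pose n := Num.floor x; pose y := x - n%:~R.
  have /andP[y0 y1] : 0 <= y < 1.
    by rewrite subr_ge0 ltrBlDl; have := floor_itv x; rewrite intrD.
  have yr : cos (2 * pi * y) = r.
    by rewrite -xr -[in RHS](subrK n%:~R x) cos_2piD_int.
  have [yh|yh] := leP y (1 / 2).
    exists (n, false) => //; rewrite /= expr0 mul1r /c -yr cosK.
      by rewrite /y; field; lra.
    by rewrite in_itv /=; apply/andP; split; nra.
  (* On the second half of the period the angle is reflected to [2 pi - 2 pi y], which lies in the
     range of [acos]; hence [n + 1]. *)
  exists (n + 1, true) => //; rewrite /= expr1 /c.
  rewrite -yr -cosN -(cosD2pi (- _)) cosK.
    by rewrite /y intrD -mulr_natr; field; lra.
  by rewrite in_itv /= -mulr_natr; apply/andP; split; nra.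
by apply: sub_countable (card_image_le _ _) _; exact: countableP.
Qed.

(** This permits comparing coefficients in identities that hold only after multiplication by [g];
    [t3] and [t4] belong to the second harmonics. *)
Lemma trig_poly_ae_eq0 (t0 t1 t2 t3 t4 : R) g :
  ~ {ae mu, forall x, g x = 0} ->
  {ae mu, forall x, let C := cos (2 * pi * x) in let S := sin (2 * pi * x) in
    (t0 + t1 * C + t2 * S + t3 * (C ^+ 2 - S ^+ 2) + t4 * (2 * C * S)) * g x
    = 0} ->
  [/\ t0 = 0, t1 = 0, t2 = 0, t3 = 0 & t4 = 0].
Proof.
move=> g0 tg.
(* Writing the polynomial as [A(C) + S B(C)], its zeros satisfy
   [A(C) ^ 2 - (1 - C ^ 2) B(C) ^ 2 = 0], a polynomial equation in [C]. *)
pose p : {poly R} := Poly [:: (t0 - t3) ^+ 2 - t2 ^+ 2;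
  2 * (t0 - t3) * t1 - 4 * t2 * t4;
  t1 ^+ 2 + 4 * (t0 - t3) * t3 - 4 * t4 ^+ 2 + t2 ^+ 2;
  4 * t1 * t3 + 4 * t2 * t4;
  4 * t3 ^+ 2 + 4 * t4 ^+ 2].
have [p0|p0] := eqVneq p 0.
  have pk k : p`_k = 0 by rewrite p0 coef0.
  have := pk 4; have := pk 2; have := pk 0; rewrite !coef_Poly /= => e0 e2 e4.
  (* The leading coefficient is a sum of squares; once [t3] and [t4] vanish, the coefficient of
     degree 2 is [t1 ^ 2 + t2 ^ 2]. *)
  have t30 : t3 = 0 by apply/eqP; rewrite -sqrf_eq0; apply/eqP; nra.
  have t40 : t4 = 0 by apply/eqP; rewrite -sqrf_eq0; apply/eqP; nra.
  rewrite t30 t40 in e0 e2.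
  have t10 : t1 = 0 by apply/eqP; rewrite -sqrf_eq0; apply/eqP; nra.
  have t20 : t2 = 0 by apply/eqP; rewrite -sqrf_eq0; apply/eqP; nra.
  have t00 : t0 = 0.
    by apply/eqP; rewrite -sqrf_eq0; apply/eqP; rewrite t20 in e0; nra.
  by [].
exfalso; apply: g0.
pose Z := [set x : R | root p (cos (2 * pi * x))].
have cZ : countable Z.
  rewrite (_ : Z = \bigcup_(r in [set r | root p r])
    [set x | cos (2 * pi * x) = r]).
    apply: bigcup_countable; first exact/finite_set_countable/finite_set_roots.
    by move=> r _; exact: countable_cos_fiber.
  apply/seteqP; split=> x /=; first by move=> rx; exists (cos (2 * pi * x)).
  by rewrite /Z /=; case=> r rr /= ->.
have nZ : {ae mu, forall x, ~ Z x}.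
  exists Z; split.
  - exact: countable_measurable.
  - exact: countable_lebesgue_measure0.
  - by move=> x /= /contrapT.
apply: filterS2 nZ tg => x /= Zx /eqP.
rewrite mulf_eq0 => /orP[/eqP e|/eqP//].
exfalso; apply: Zx; rewrite /Z /= /root /p horner_Poly /=.
move: e (cos2Dsin2 (2 * pi * x)).
move: (cos _) (sin _) => C S e CS; apply/eqP.
(* The second factor is the first with [S] negated, so the product is even in [S] and becomes a
   polynomial in [C]. *)
transitivity ((t0 + t1 * C + t2 * S + t3 * (C ^+ 2 - S ^+ 2) + t4 * (2 * C * S))
  * (t0 + t1 * C - t2 * S + t3 * (C ^+ 2 - S ^+ 2) - t4 * (2 * C * S)));
  last first.
  by rewrite e mul0r.
transitivity ((t0 + t1 * C + t3 * (C ^+ 2 - S ^+ 2)) ^+ 2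
  - S ^+ 2 * (t2 + 2 * t4 * C) ^+ 2); last by ring.
by rewrite (_ : S ^+ 2 = 1 - C ^+ 2); [ring | rewrite -CS; ring].
Qed.

End trigonometric_polynomials.

(** * Translates given by multipliers of degree one *)

Section first_order.
Context {R : realType}.
Local Open Scope classical_set_scope.
Local Open Scope ring_scope.
Notation mu := (@lebesgue_measure R).
Implicit Types (g : R -> R) (x r a b : R).
#[local] Existing Instance lebesgue_ae_filter.

Definition trig1 (p0 p1 p2 x : R) :=
  p0 + p1 * cos (2 * pi * x) + p2 * sin (2 * pi * x).

Lemma measurable_trig1 p0 p1 p2 : measurable_fun setT (trig1 p0 p1 p2).
Proof.
have m2 : measurable_fun setT (fun x : R => 2 * pi * x).
  exact: measurable_funM.
apply: measurable_funD; first apply: measurable_funD => //.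
  apply: measurable_funM => //; apply: measurableT_comp m2.
  exact: continuous_measurable_fun (@continuous_cos R).
apply: measurable_funM => //; apply: measurableT_comp m2.
exact: continuous_measurable_fun (@continuous_sin R).
Qed.

Lemma bounded_trig1 p0 p1 p2 : [bounded trig1 p0 p1 p2 x | x in [set: R]].
Proof.
exists (`|p0| + `|p1| + `|p2|); split; first exact: num_real.
move=> y /ltW My x _; apply: le_trans My => /=.
rewrite /trig1; apply: le_trans (ler_normD _ _) _; apply: lerD.
  apply: le_trans (ler_normD _ _) _; apply: lerD => //.
  by rewrite normrM ler_piMr// cos_max.
by rewrite normrM ler_piMr// sin_max.
Qed.

(* Comparing the two ways of translating [g] by [a + b] gives
   [P(x - b) Q(x) = Q(x - a) P(x)], and non-proportionality of the first
   harmonics of [P] and [Q] leaves only [P(x - a) = P(x)] or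
   [P(x - a) = - P(x)]. *)
Lemma trig1_commute a b p0 p1 p2 q0 q1 q2 g :
  ~ {ae mu, forall x, g x = 0} -> p1 * q2 - p2 * q1 != 0 ->
  {ae mu, forall x, g (x - a) = trig1 p0 p1 p2 x * g x} ->
  {ae mu, forall x, g (x - b) = trig1 q0 q1 q2 x * g x} ->
  forall x, trig1 p0 p1 p2 (x - a) ^+ 2 = trig1 p0 p1 p2 x ^+ 2.
Proof.
move=> g0 pq gP gQ.
set ca := cos (2 * pi * a); set sa := sin (2 * pi * a).
set cb := cos (2 * pi * b); set sb := sin (2 * pi * b).
(* Translation by [t] rotates the pair of first-harmonic coefficients by the angle [2 pi t]. *)
have shift r1 r2 x t : r1 * cos (2 * pi * (x - t)) + r2 * sin (2 * pi * (x - t))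
  = (r1 * cos (2 * pi * t) - r2 * sin (2 * pi * t)) * cos (2 * pi * x)
  + (r1 * sin (2 * pi * t) + r2 * cos (2 * pi * t)) * sin (2 * pi * x).
  by rewrite mulrBr cosB sinB; ring.
have a1 : ca ^+ 2 + sa ^+ 2 = 1 by exact: cos2Dsin2.
pose u1 := p1 * cb - p2 * sb; pose u2 := p1 * sb + p2 * cb.
pose v1 := q1 * ca - q2 * sa; pose v2 := q1 * sa + q2 * ca.
(* The Fourier coefficients of [P(x - b) Q(x) - Q(x - a) P(x)], with [u] and [v] the rotated
   coefficients of [P] and [Q]. *)
have [] := trig_poly_ae_eq0
  (p0 * q0 + (u1 * q1 + u2 * q2) / 2 - (q0 * p0 + (v1 * p1 + v2 * p2) / 2))
  (p0 * q1 + u1 * q0 - (q0 * p1 + v1 * p0))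
  (p0 * q2 + u2 * q0 - (q0 * p2 + v2 * p0))
  ((u1 * q1 - u2 * q2) / 2 - (v1 * p1 - v2 * p2) / 2)
  ((u1 * q2 + u2 * q1) / 2 - (v1 * p2 + v2 * p1) / 2) g g0.
  have gab := ae_translate b _ gP; have gba := ae_translate a _ gQ.
  apply: filterS2 (filterI gP gQ) (filterI gab gba) => x [eP eQ] [ePb eQa] /=.
  have e : trig1 p0 p1 p2 (x - b) * (trig1 q0 q1 q2 x * g x)
         = trig1 q0 q1 q2 (x - a) * (trig1 p0 p1 p2 x * g x).
    by rewrite -eP -eQ -ePb -eQa; congr g; ring.
  move: e; rewrite /trig1 -[p0 + _ + _]addrA shift.
  rewrite -[q0 + _ * cos (2 * pi * (x - a)) + _]addrA shift.
  rewrite -/ca -/sa -/cb -/sb -/u1 -/u2 -/v1 -/v2.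
  move: (cos2Dsin2 (2 * pi * x)).
  move: (cos (2 * pi * x)) (sin (2 * pi * x)) (g x) => C S G CS /eqP.
  rewrite -subr_eq0 => /eqP <-.
  rewrite (_ : (u1 * q1 + u2 * q2) / 2
    = (u1 * q1 + u2 * q2) / 2 * (C ^+ 2 + S ^+ 2)); last by rewrite CS mulr1.
  rewrite (_ : (v1 * p1 + v2 * p2) / 2
    = (v1 * p1 + v2 * p2) / 2 * (C ^+ 2 + S ^+ 2)); last by rewrite CS mulr1.
  by field.
move=> e0 e1 e2 e3 e4.
have P0 : p1 ^+ 2 + p2 ^+ 2 != 0.
  apply/eqP => P0; move/eqP: pq; apply.
  have p10 : p1 = 0 by apply/eqP; rewrite -sqrf_eq0; apply/eqP; nra.
  have p20 : p2 = 0 by apply/eqP; rewrite -sqrf_eq0; apply/eqP; nra.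
  by rewrite p10 p20; ring.
have Q0 : q1 ^+ 2 + q2 ^+ 2 != 0.
  apply/eqP => Q0; move/eqP: pq; apply.
  have p10 : q1 = 0 by apply/eqP; rewrite -sqrf_eq0; apply/eqP; nra.
  have p20 : q2 = 0 by apply/eqP; rewrite -sqrf_eq0; apply/eqP; nra.
  by rewrite p10 p20; ring.
(* With [p = p1 + i p2] and [q = q1 + i q2], the second harmonic is [p q (e(b) - e(a)) / 2]; this is
   four times its squared modulus. *)
have : (p1 ^+ 2 + p2 ^+ 2) * (q1 ^+ 2 + q2 ^+ 2)
    * ((cb - ca) ^+ 2 + (sb - sa) ^+ 2) = 0.
  transitivity (4 * (((u1 * q1 - u2 * q2) / 2 - (v1 * p1 - v2 * p2) / 2) ^+ 2
    + ((u1 * q2 + u2 * q1) / 2 - (v1 * p2 + v2 * p1) / 2) ^+ 2)).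
    by rewrite /u1 /u2 /v1 /v2; field.
  by rewrite e3 e4; ring.
move/eqP; rewrite !mulf_eq0 (negPf P0) (negPf Q0) /= paddr_eq0 ?sqr_ge0//.
rewrite !sqrf_eq0 !subr_eq0 => /andP[/eqP cba /eqP sba].
rewrite /u1 /u2 /v1 /v2 cba sba in e0 e1 e2.
(* After the substitution the constant coefficient is [sa] times the determinant [p1 q2 - p2 q1]. *)
have sa0 : sa = 0.
  apply: (mulfI pq); rewrite mulr0 -e0; by field.
have ca1 : (ca == 1) || (ca == -1).
  by rewrite -sqrf_eq1 -a1 sa0 expr0n addr0.
move=> x; rewrite /trig1 -![p0 + _ + _]addrA shift -/ca -/sa.
rewrite sa0 !mulr0 subr0 add0r.
case/orP: ca1 => /eqP ca1; rewrite ca1 ?sa0 in e1 e2 *; first by ring.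
(* Here translation negates the harmonics. The first-order coefficients make [p0 q] equal to [q0 p],
   so non-proportionality forces [p0 = 0]. *)
suff -> : p0 = 0 by ring.
have f1 : p0 * q1 = q0 * p1 by lra.
have f2 : p0 * q2 = q0 * p2 by lra.
apply: (mulfI pq); rewrite mulr0.
transitivity (p1 * (p0 * q2) - p2 * (p0 * q1)); first by ring.
by rewrite f1 f2; ring.
Qed.

(** The multiplier argument gives [(P ^ 2 - 1) g = 0], and the second harmonics of [P ^ 2 - 1]
    vanish only if [p1 = p2 = 0]. *)
Lemma trig1_translates_absurd a b p0 p1 p2 q0 q1 q2 g :
  square_integrable g ->
  ~ {ae mu, forall x, g x = 0} -> p1 * q2 - p2 * q1 != 0 ->
  {ae mu, forall x, g (x - a) = trig1 p0 p1 p2 x * g x} ->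
  {ae mu, forall x, g (x - b) = trig1 q0 q1 q2 x * g x} -> False.
Proof.
move=> g2 g0 pq gP gQ.
have perP := trig1_commute a b p0 p1 p2 q0 q1 q2 g g0 pq gP gQ.
have P1 := ae_translate_multiplier a _ g g2 (measurable_trig1 p0 p1 p2)
  (bounded_trig1 p0 p1 p2) perP gP.
have [] := trig_poly_ae_eq0 (p0 ^+ 2 + (p1 ^+ 2 + p2 ^+ 2) / 2 - 1)
  (2 * p0 * p1) (2 * p0 * p2) ((p1 ^+ 2 - p2 ^+ 2) / 2) (p1 * p2) g g0.
  apply: filterS P1 => x /=; rewrite /trig1.
  move: (cos2Dsin2 (2 * pi * x)).
  move: (cos (2 * pi * x)) (sin (2 * pi * x)) (g x) => C S G CS <-.
  rewrite (_ : (p1 ^+ 2 + p2 ^+ 2) / 2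
    = (p1 ^+ 2 + p2 ^+ 2) / 2 * (C ^+ 2 + S ^+ 2)); last by rewrite CS mulr1.
  by field.
move=> _ _ _ e3 /eqP; rewrite mulf_eq0 => p12; move/eqP: pq; apply.
have [p10 p20] : p1 = 0 /\ p2 = 0.
  by case/orP: p12 => /eqP e; rewrite e in e3 *; split=> //; apply/eqP;
    rewrite -sqrf_eq0; apply/eqP; lra.
by rewrite p10 p20; ring.
Qed.

Lemma re_im_translates_absurd a b (r0 s0 r1 s1 r2 s2 r3 s3 : R) g :
  square_integrable g -> ~ {ae mu, forall x, g x = 0} ->
  r1 ^+ 2 + s1 ^+ 2 != 0 ->
  {ae mu, forall x,
    trig1 r0 r1 (- s1) x * g x + r2 * g (x - a) + r3 * g (x - b) = 0} ->
  {ae mu, forall x,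
    trig1 s0 s1 r1 x * g x + s2 * g (x - a) + s3 * g (x - b) = 0} -> False.
Proof.
move=> g2 g0 c1 gr gs.
(* A combination that cancels both translates leaves a trigonometric polynomial whose first harmonic
   has squared norm [(al ^ 2 + be ^ 2) (r1 ^ 2 + s1 ^ 2)]. *)
have elim al be : al * r2 + be * s2 = 0 -> al * r3 + be * s3 = 0 ->
    al ^+ 2 + be ^+ 2 = 0.
  move=> e2 e3.
  have [] := trig_poly_ae_eq0 (al * r0 + be * s0) (al * r1 + be * s1)
    (- al * s1 + be * r1) 0 0 g g0.
    apply: filterS2 gr gs => x er es /=.
    transitivity (
      al * (trig1 r0 r1 (- s1) x * g x + r2 * g (x - a) + r3 * g (x - b))
      + be * (trig1 s0 s1 r1 x * g x + s2 * g (x - a) + s3 * g (x - b))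
      - (al * r2 + be * s2) * g (x - a) - (al * r3 + be * s3) * g (x - b)).
      by rewrite /trig1; ring.
    by rewrite er es e2 e3; ring.
  move=> _ e e' _ _; apply: (mulfI c1); rewrite mulr0.
  transitivity ((al * r1 + be * s1) ^+ 2 + (- al * s1 + be * r1) ^+ 2).
    by ring.
  by rewrite e e'; ring.
pose D := r2 * s3 - s2 * r3.
have [D0|D0] := eqVneq D 0.
  (* When [D = 0], each of [(s2, - r2)] and [(s3, - r3)] cancels both translates; if all four
     entries vanish, so does [(1, 0)]. *)
  have z2 : s2 ^+ 2 + (- r2) ^+ 2 = 0.
    by apply: elim; [ring|rewrite -[RHS]oppr0 -D0 /D; ring].
  have z3 : s3 ^+ 2 + (- r3) ^+ 2 = 0.
    by apply: elim; [rewrite -D0 /D; ring|ring].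
  have sq0 (u v : R) : u ^+ 2 + (- v) ^+ 2 = 0 -> u = 0 /\ v = 0.
    by move=> ?; split; apply/eqP; rewrite -sqrf_eq0; apply/eqP; nra.
  have [[s20 r20] [s30 r30]] := (sq0 _ _ z2, sq0 _ _ z3).
  suff /eqP : (1 : R) ^+ 2 + 0 ^+ 2 = 0.
    by rewrite expr1n expr0n addr0 oner_eq0.
  by apply: elim; rewrite ?s20 ?r20 ?s30 ?r30; ring.
(* Cramer's rule for [g(x - a)] and [g(x - b)]; the determinant of the first harmonics is then
   [(r1 ^ 2 + s1 ^ 2) / D]. *)
apply: (trig1_translates_absurd a b
  ((r3 * s0 - s3 * r0) / D) ((r3 * s1 - s3 * r1) / D) ((r3 * r1 + s3 * s1) / D)
  ((s2 * r0 - r2 * s0) / D) ((s2 * r1 - r2 * s1) / D)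
  ((- s2 * s1 - r2 * r1) / D)
  g) => //.
- rewrite (_ : _ - _ = (r1 ^+ 2 + s1 ^+ 2) / D).
    by rewrite mulf_neq0// invr_neq0.
  by apply: (mulIf (expf_neq0 2 D0)); rewrite /D in D0 *; field.
- apply: filterS2 gr gs => x er es; apply: (mulfI D0); apply/eqP.
  rewrite -subr_eq0; apply/eqP.
  transitivity (
    s3 * (trig1 r0 r1 (- s1) x * g x + r2 * g (x - a) + r3 * g (x - b))
    - r3 * (trig1 s0 s1 r1 x * g x + s2 * g (x - a) + s3 * g (x - b))).
    by rewrite /trig1 /D in D0 *; field.
  by rewrite er es; ring.
- apply: filterS2 gr gs => x er es; apply: (mulfI D0); apply/eqP.
  rewrite -subr_eq0; apply/eqP.
  transitivity (r2 * (trig1 s0 s1 r1 x * g x + s2 * g (x - a) + s3 * g (x - b))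
    - s2 * (trig1 r0 r1 (- s1) x * g x + r2 * g (x - a) + r3 * g (x - b))).
    by rewrite /trig1 /D in D0 *; field.
  by rewrite er es; ring.
Qed.

End first_order.

(** * Reduction of the complex relation to its real and imaginary parts *)

Theorem theorem3p6 (R : realType) (g : R -> R) (a b : R)
  (gmeas : measurable_fun setT g)
  (gnorm : (\int[lebesgue_measure]_x ((g x) ^+ 2)%:E = 1)%E)
  (a0 : a != 0) (b0 : b != 0) (ab : a != b) :
  forall c0 c1 c2 c3 : R[i],
    {ae lebesgue_measure, forall x : R, tf_comb g a b c0 c1 c2 c3 x = 0} ->
    [/\ c0 = 0, c1 = 0, c2 = 0 & c3 = 0].
Proof.
move=> [r0 s0] [r1 s1] [r2 s2] [r3 s3] comb.
have FI := @lebesgue_ae_filter R.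
have mg2 : measurable_fun setT (EFin \o (fun x => g x ^+ 2)).
  by apply/measurable_EFinP; exact: measurable_funX.
have g2 : square_integrable g.
  split=> //; apply/integrableP; split=> //.
  rewrite (_ : (\int[_]_x _ = 1)%E) ?ltry// -gnorm.
  by apply: eq_integral => x _ /=; rewrite ger0_norm ?sqr_ge0.
have g0 : ~ {ae lebesgue_measure, forall x, g x = 0}.
  move=> g0.
  have : (\int[lebesgue_measure]_x (g x ^+ 2)%:E
      = \int[lebesgue_measure]_(x in [set: R]) (cst 0 x))%E.
    apply: ae_eq_integral => //.
    suff : {ae lebesgue_measure, forall x : R, setT x -> (g x ^+ 2)%:E = 0%E}.
      by [].
    by apply: filterS g0 => x -> _; rewrite expr0n.
  by rewrite gnorm integral0 => -[] /eqP; rewrite oner_eq0.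
have gr : {ae lebesgue_measure, forall x,
    trig1 r0 r1 (- s1) x * g x + r2 * g (x - a) + r3 * g (x - b) = 0}.
  apply: filterS comb => x; rewrite /tf_comb; simpc => -[er _].
  by rewrite -er /trig1; ring.
have gs : {ae lebesgue_measure, forall x,
    trig1 s0 s1 r1 x * g x + s2 * g (x - a) + s3 * g (x - b) = 0}.
  apply: filterS comb => x; rewrite /tf_comb; simpc => -[_ es].
  by rewrite -es /trig1; ring.
have [c1|c1] := eqVneq (r1 ^+ 2 + s1 ^+ 2) 0; last first.
  by have := re_im_translates_absurd a b _ _ _ _ _ _ _ _ _ g2 g0 c1 gr gs.
have r10 : r1 = 0 by apply/eqP; rewrite -sqrf_eq0; apply/eqP; nra.
have s10 : s1 = 0 by apply/eqP; rewrite -sqrf_eq0; apply/eqP; nra.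
have [-> -> ->] : [/\ r0 = 0, r2 = 0 & r3 = 0].
  apply: (ae_three_translates a b _ _ _ g) => //.
  by apply: filterS gr => x <-; rewrite /trig1 r10 s10; ring.
have [-> -> ->] : [/\ s0 = 0, s2 = 0 & s3 = 0].
  apply: (ae_three_translates a b _ _ _ g) => //.
  by apply: filterS gs => x <-; rewrite /trig1 r10 s10; ring.
by rewrite r10 s10.
Qed.
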